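(* Let $N$ be a positive even integer, $\alpha>0$, and let $\Phi:[0,1]^2\times(\mathbb{R}^2\setminus\{0\})\to\mathbb{R}$ be homogeneous of degree one in $\xi$. Let $\hat\xi_\ell$ be a unit vector, let $W_\ell$ be the set of $\xi$ in the square $[-\frac N2,\frac N2-1]^2$ whose angle with $\hat\xi_\ell$ is at most $\frac{\alpha}{\sqrt N}$, and let $\Phi_\ell(x,\xi)=\Phi(x,\xi)-\nabla_\xi\Phi(x,\hat\xi_\ell)\cdot\xi$. Assume $\Phi_\ell(x,\xi)$ is measurable in $x$ and $(Q,R)$-analytic in $\xi$ for some constants $Q,R>0$, and that $\alpha$ is admissible in the sense that $$\alpha<\min\Big\{\frac{R\sqrt N}{2},\ \frac{R}{\sqrt{\sqrt2\,Q}}\Big\}.$$ Then for every $p>\frac{2}{\log_2\left(\frac{R\sqrt N}{\alpha}\right)}$ there is a constant $C_p>0$, not depending on $\epsilon$, such that for all $0<\epsilon\le1$ the $\epsilon$-separation rank of $e^{2\pi i\Phi_\ell(x,\xi)}$ for $x\in[0,1]^2$, $\xi\in W_\ell$ obeys $r_\epsilon\le C_p\,\epsilon^{-p}$.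
   Context: A function $F(x,\xi)$ is called $(Q,R)$-analytic in $\xi$ if for each $x$ it is real-analytic in $\xi\neq0$ and, with $\theta=\arg\xi$, $2\pi\sup_{|\xi|=1}|\partial_\theta^kF(x,\xi)|\le Q\,k!\,R^{-k}$ for all integers $k\ge0$. For a function $f(x,\xi)$ on a product domain $D_1\times D_2$ and $\epsilon>0$, the $\epsilon$-separation rank is the smallest integer $r_\epsilon$ for which there exist functions $c_n$ on $D_1$, $d_n$ on $D_2$ ($0\le n\le r_\epsilon-1$) with $|f(x,\xi)-\sum_{n=0}^{r_\epsilon-1}c_n(x)d_n(\xi)|\le\epsilon$ for all $(x,\xi)\in D_1\times D_2$. *)

(* Defs.v *)
From HB Require Import structures.
From mathcomp Require Import all_boot all_order all_algebra.
From mathcomp Require Import all_classical all_reals all_analysis.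
From mathcomp Require Import complex.
Set Implicit Arguments. Unset Strict Implicit. Unset Printing Implicit Defensive.
Import Order.TTheory GRing.Theory Num.Theory.
Import numFieldNormedType.Exports.
Local Open Scope classical_set_scope.
Local Open Scope ring_scope.

Section Defs.
Variable R : realType.

Definition dot2 (u v : R * R) : R := u.1 * v.1 + u.2 * v.2.
Definition enorm2 (u : R * R) : R := Num.sqrt (dot2 u u).

Definition angle2 (u v : R * R) : R := acos (dot2 u v / (enorm2 u * enorm2 v)).

Definition expi (t : R) : R[i] := (cos t +i* sin t)%C.

Definition psum2 (a : nat -> nat -> R) (h : R * R) (n : nat) : R :=
  \sum_(i < n) \sum_(j < n) a i j * h.1 ^+ i * h.2 ^+ j.

Definition real_analytic_at (f : R * R -> R) (z : R * R) : Prop :=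
  exists r : R, 0 < r /\ exists a : nat -> nat -> R,
    forall h : R * R, `|h.1| < r -> `|h.2| < r ->
      cvg (psum2 (fun i j => `|a i j|) (`|h.1|, `|h.2|) @ \oo) /\
      (psum2 a h @ \oo --> f (z + h)).

Definition QR_analytic (D : set (R * R)) (F : R * R -> R * R -> R) (Q Rr : R) : Prop :=
  forall x, D x ->
    (forall xi : R * R, xi != 0 -> real_analytic_at (F x) xi) /\
    (forall (k : nat) (theta : R),
       2 * pi * `| (derive1n k (fun t : R => F x (cos t, sin t))) theta |
         <= Q * (k`!)%:R * Rr ^- k).

Definition sep_approx (D1 D2 : set (R * R)) (f : R * R -> R * R -> R[i])
    (eps : R) (r : nat) : Prop :=
  exists (c d : nat -> R * R -> R[i]),
    forall x xi, D1 x -> D2 xi ->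
      `| f x xi - \sum_(n < r) c n x * d n xi | <= (eps%:C)%C.

(* the eps-separation rank: smallest such r (+oo if none) *)
Definition sep_rank (D1 D2 : set (R * R)) (f : R * R -> R * R -> R[i])
    (eps : R) : \bar R :=
  ereal_inf [set (r%:R)%:E | r in [set r | sep_approx D1 D2 f eps r]].

Definition unit_square : set (R * R) := `[0, 1]%classic `*` `[0, 1]%classic.

Definition wedge (N : nat) (alpha : R) (xih : R * R) : set (R * R) :=
  [set xi | xi != 0 /\
     - (N%:R / 2) <= xi.1 <= N%:R / 2 - 1 /\
     - (N%:R / 2) <= xi.2 <= N%:R / 2 - 1 /\
     angle2 xi xih <= alpha / Num.sqrt (N%:R)].

End Defs.
Arguments unit_square {R}.

(* Main.v *)
Require Import Defs.
From HB Require Import structures.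
From mathcomp Require Import all_boot all_order all_algebra.
From mathcomp Require Import all_classical all_reals all_analysis.
From mathcomp Require Import complex ring lra zify.
Set Implicit Arguments. Unset Strict Implicit. Unset Printing Implicit Defensive.
Import Order.TTheory GRing.Theory Num.Theory.
Import numFieldNormedType.Exports.
Local Open Scope classical_set_scope.
Local Open Scope ring_scope.

(** By homogeneity, [2 pi Phil x xi = |xi| G_x(th + tau)], where [th] is the
    angle of [xih] and [tau] the signed angle from [xih] to [xi], so that
    [|tau| / Rr <= alpha / (Rr sqrt N) < 1/2] on the wedge.  The bounds on the
    angular derivatives make the Taylor polynomial [P_x] of degree [< n] of
    [G_x] at [th] accurate to [Q 2^-n], and the exponential series truncated at
    order [n] is accurate to [O(2^-n)] because the phase is bounded.  The powers
    of [|xi| P_x(tau)] are combinations of the functions [|xi|^m tau^j] with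
    [m < n] and [j < n^2], hence accuracy [C 2^-n] costs rank at most [n^3]:
    the rank is polylogarithmic in [1/eps], which is better than any power.

    That [G_x] is smooth does not need the calculus of double power series:
    homogeneity writes the function on the arcs [+-cos > 0] and [+-sin > 0] as,
    e.g., [cos t * F(1, tan t)], and [s |-> F(1, s)] is locally a power series
    in one variable. *)

(** * Taylor polynomials and remainder bounds *)

Section Taylor.
Variable R : realType.

Definition taylor_poly (n : nat) (c : nat -> R) : {poly R} :=
  \poly_(k < n) (c k / k`!%:R).

Lemma deriv_taylor_poly n c :
  (taylor_poly n.+1 c)^`() = taylor_poly n (fun k => c k.+1).
Proof.
apply/polyP => k; rewrite coef_deriv !coef_poly ltnS.
case: ifP => _; last by rewrite mul0rn.
rewrite factS natrM -mulr_natr; field.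
by rewrite nat1r !pnatr_eq0 -lt0n fact_gt0.
Qed.

Lemma horner_taylor_poly0 n c : (taylor_poly n.+1 c).[0] = c 0%N.
Proof. by rewrite horner_coef0 coef_poly fact0 divr1. Qed.

Lemma horner_taylor_poly n c t :
  (taylor_poly n c).[t] = \sum_(k < n) c k / k`!%:R * t ^+ k.
Proof. exact: horner_poly. Qed.

(** By induction on [n]: the polynomial minus [f 0] vanishes at 0, and its derivative is the same
    difference for the shifted sequences, nonnegative by hypothesis; the mean value theorem
    concludes. *)
Lemma taylor_le (n : nat) (f : nat -> R -> R) (c : nat -> R) :
  (forall k (t : R), (k < n)%N -> is_derive t (1 : R) (f k) (f k.+1 t)) ->
  (forall k, (k < n)%N -> f k 0 = c k) ->
  (forall t, f n t <= c n) ->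
  forall t, 0 <= t -> f 0%N t <= (taylor_poly n.+1 c).[t].
Proof.
elim: n f c => [|n IH] f c df f0 fn t t0.
  by rewrite horner_taylor_poly big_ord1 fact0 divr1 expr0 mulr1.
have f1 s : 0 <= s -> f 1%N s <= (taylor_poly n.+1 (fun k => c k.+1)).[s].
  move=> s0; apply: (IH (fun k => f k.+1) (fun k => c k.+1)) => //.
  - by move=> k u kn; apply: df.
  - by move=> k kn; apply: f0.
pose h := horner (taylor_poly n.+2 c) - f 0%N.
pose dh s := (taylor_poly n.+1 (fun k => c k.+1)).[s] - f 1%N s.
have hd (s : R) : is_derive s (1 : R) h (dh s).
  rewrite /dh -deriv_taylor_poly; apply: is_deriveB; exact: df.
have hc : {within `[0, t], continuous h}.
  by apply: derivable_within_continuous => s _; have [] := hd s.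
have [s] := MVT_segment t0 (fun s _ => hd s) hc.
rewrite in_itv/= => /andP[s0 _].
rewrite /h /= !fctE horner_taylor_poly0 f0// subrr subr0 => e.
by rewrite -subr_ge0 e mulr_ge0// subr_ge0 // f1.
Qed.

Lemma taylor_bound (n : nat) (f : nat -> R -> R) (M a t : R) :
  (forall k (s : R), is_derive s (1 : R) (f k) (f k.+1 s)) ->
  (forall s, `|f n s| <= M) ->
  `|f 0%N (a + t) - \sum_(k < n) f k a / k`!%:R * t ^+ k|
    <= M * `|t| ^+ n / n`!%:R.
Proof.
move=> df fM.
(* Rescaling to the segment [0, 1] handles both signs of [t] at once, and the
   factor [e = 1, -1] both inequalities. *)
have one_sided (e : R) : `|e| = 1 ->
    e * (f 0%N (a + t) - \sum_(k < n) f k a / k`!%:R * t ^+ k)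
      <= M * `|t| ^+ n / n`!%:R.
  move=> e1.
  pose F k s := e * t ^+ k * f k (a + t * s).
  (* The last coefficient bounds [F n], so the polynomial at 1 is the Taylor sum plus the remainder
     bound. *)
  pose c k := if (k < n)%N then e * t ^+ k * f k a else M * `|t| ^+ n.
  have := @taylor_le n F c _ _ _ 1 ler01; rewrite horner_taylor_poly big_ord_recr/=.
  rewrite /F /c ltnn expr0 !mulr1 expr1n mulr1 => H.
  rewrite mulrBr lerBlDl; apply: (le_trans (H _ _ _)).
  - move=> k s _.
    have d1 : is_derive s (1 : R) (fun s => a + t * s) t.
      by apply: is_derive_eq; rewrite /GRing.scale/=; ring.
    have d2 := @is_derive1_comp _ (f k) (fun s => a + t * s) s _ _ (df k _) d1.
    have := @is_deriveZ _ _ _ _ (e * t ^+ k) _ _ _ d2.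
    move=> d3; apply: (is_derive_eq d3).
    by rewrite /GRing.scale/= exprS; ring.
  - by move=> k kn; rewrite kn mulr0 addr0.
  - move=> s; apply: (le_trans (ler_norm _)).
    by rewrite !normrM e1 mul1r normrX mulrC ler_wpM2r ?exprn_ge0.
  - rewrite mulr_sumr lerD2r le_eqVlt; apply/orP; left; apply/eqP.
    apply: eq_bigr => k _; rewrite ltn_ord expr1n mulr1; ring.
rewrite ler_norml; apply/andP; split.
  by rewrite lerNl -mulN1r; apply: one_sided; rewrite normrN1.
by rewrite -[leLHS]mul1r; apply: one_sided; rewrite normr1.
Qed.

(** A quarter turn of the argument differentiates, so these shifts run through all derivatives of
    [cos], each bounded by 1. *)
Lemma is_derive_cos_shift (k : nat) (t : R) :
  is_derive t (1 : R) (fun s => cos (s + k%:R * (pi / 2))) (cos (t + k.+1%:R * (pi / 2))).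
Proof.
apply: is_derive_eq.
have -> : t + k.+1%:R * (pi / 2) = t + k%:R * (pi / 2) + pi / 2.
  by rewrite -(natr1 k); ring.
by rewrite cosDpihalf /GRing.scale/=; ring.
Qed.

Lemma is_derive_sin_shift (k : nat) (t : R) :
  is_derive t (1 : R) (fun s => sin (s + k%:R * (pi / 2))) (sin (t + k.+1%:R * (pi / 2))).
Proof.
apply: is_derive_eq.
have -> : t + k.+1%:R * (pi / 2) = t + k%:R * (pi / 2) + pi / 2.
  by rewrite -(natr1 k); ring.
by rewrite sinDpihalf /GRing.scale/=; ring.
Qed.

Lemma cos_taylor_bound (n : nat) (a t : R) :
  `|cos (a + t) - \sum_(k < n) cos (a + k%:R * (pi / 2)) / k`!%:R * t ^+ k|
    <= `|t| ^+ n / n`!%:R.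
Proof.
have := @taylor_bound n (fun k s => cos (s + k%:R * (pi / 2))) 1 a t
  is_derive_cos_shift (fun s => cos_max _).
by rewrite mul0r addr0 mul1r.
Qed.

Lemma sin_taylor_bound (n : nat) (a t : R) :
  `|sin (a + t) - \sum_(k < n) sin (a + k%:R * (pi / 2)) / k`!%:R * t ^+ k|
    <= `|t| ^+ n / n`!%:R.
Proof.
have := @taylor_bound n (fun k s => sin (s + k%:R * (pi / 2))) 1 a t
  is_derive_sin_shift (fun s => sin_max _).
by rewrite mul0r addr0 mul1r.
Qed.
End Taylor.

(** * Power series in one variable *)

Section PowerSeries.
Variable R : realType.

(** Partial sums times [(1 - q)^2] have a closed form at most 1, so they are nondecreasing and
    bounded. *)
Lemma is_cvg_series_succ_geometric (q : R) : 0 <= q < 1 ->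
  cvgn (series (fun n => n.+1%:R * q ^+ n)).
Proof.
move=> /andP[q0 q1].
have sumE n : series (fun n => n.+1%:R * q ^+ n) n * (1 - q) ^+ 2
    = 1 - n.+1%:R * q ^+ n + n%:R * q ^+ n.+1.
  rewrite /series/=; elim: n => [|n IH].
    by rewrite big_geq// !mul0r mul1r expr0 subrr addr0.
  by rewrite big_nat_recr//= mulrDl IH -(natr1 n.+1) -(natr1 n) !exprS; ring.
have q1' : 0 < (1 - q) ^+ 2 by rewrite exprn_gt0// subr_gt0.
apply: nondecreasing_is_cvgn.
  by apply: nondecreasing_series => n _ _; rewrite mulr_ge0// exprn_ge0.
exists ((1 - q) ^- 2) => _ [n _ <-].
rewrite -[leRHS]mul1r ler_pdivlMr// sumE.
rewrite -addrA gerDl addrC subr_le0 exprS mulrCA -natr1 mulrDl mul1r.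
rewrite (@le_trans _ _ (n%:R * q ^+ n))//; last by rewrite lerDl exprn_ge0.
by rewrite ler_piMl ?mulr_ge0 ?exprn_ge0// ltW.
Qed.

(** The terms [c n * K ^+ n] tend to 0, hence are bounded, so the differentiated series at [z] is
    dominated by a multiple of [(n + 1) (|z| / |K|)^n]. *)
Lemma is_cvg_pseries_diffs_inside (c : R ^nat) (K z : R) :
  cvgn (pseries c K) -> `|z| < `|K| -> cvgn (pseries (pseries_diffs c) z).
Proof.
move=> cK zK.
have K0 : 0 < `|K| by rewrite (le_lt_trans _ zK).
have [B [_ cB]] := cvg_seq_bounded (cvgP _ (cvg_series_cvg_0 cK)).
have {}cB n : `|c n| <= (B + 1) * `|K| ^- n.
  have := cB (B + 1) _ n I; rewrite ltrDl => /(_ ltr01).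
  by rewrite /= normrM normrX ler_pdivlMr ?exprn_gt0.
apply: normed_cvg.
apply: (@series_le_cvg _ _ (fun n => ((B + 1) / `|K|) *
   (n.+1%:R * (`|z| / `|K|) ^+ n))).
- by move=> n; rewrite /= normr_ge0.
- move=> n; rewrite mulr_ge0// ?mulr_ge0// ?exprn_ge0// ?divr_ge0//.
  by have := cB 0%N; rewrite expr0 invr1 mulr1; apply: le_trans.
- move=> n; rewrite /pseries_diffs/= !normrM normrX normr_nat.
  have -> : (B + 1) / `|K| * (n.+1%:R * (`|z| / `|K|) ^+ n) =
     n.+1%:R * ((B + 1) * `|K| ^- n.+1) * `|z| ^+ n.
    by rewrite expr_div_n exprS invfM; ring.
  by rewrite ler_wpM2r ?exprn_ge0// ler_wpM2l.
- apply: is_cvg_seriesZ; apply: is_cvg_series_succ_geometric.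
  by rewrite divr_ge0//= ltr_pdivrMr// mul1r.
Qed.

(** Real analyticity on the line; radius and coefficients depend on the centre [s]. *)
Definition locally_pseries (psi : R -> R) : Prop := forall s : R,
  exists r : R, 0 < r /\ exists a : nat -> R, forall h : R, `|h| < r ->
    pseries a h @ \oo --> psi (s + h).

Lemma locally_pseries_derive (psi : R -> R) : locally_pseries psi ->
  (forall s : R, is_derive s (1 : R) psi (derive1 psi s)) /\
  locally_pseries (derive1 psi).
Proof.
move=> lp.
have main (s : R) : exists r : R, 0 < r /\ exists a : nat -> R, forall h : R, `|h| < r ->
    is_derive (s + h) (1 : R) psi (limn (pseries a h)) /\ cvgn (pseries a h).
  have [r [r0 [a ha]]] := lp s; exists r; split=> //.
  (* Termwise differentiation at [h] uses convergence at some [K] farther out, of the series and of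
     its first two formal derivatives. *)
  have mid (h : R) : `|h| < r -> exists2 K : R, `|h| < `|K| & `|K| < r.
    have h0 := normr_ge0 h.
    by move=> hr; exists ((`|h| + r) / 2); rewrite (@ger0_norm _ (_ / _)); lra.
  have c0 h : `|h| < r -> cvgn (pseries a h) by move=> /ha; exact: cvgP.
  have dcvg b : (forall h, `|h| < r -> cvgn (pseries b h)) ->
      forall h, `|h| < r -> cvgn (pseries (pseries_diffs b) h).
    move=> cb h /mid[K hK Kr]; exact: (is_cvg_pseries_diffs_inside (cb _ Kr)).
  have c1 := dcvg _ c0; have c2 := dcvg _ c1.
  exists (pseries_diffs a) => h hr; split; last exact: c1.
  have [K hK Kr] := mid _ hr.
  have d1 := pseries_snd_diffs (c0 _ Kr) (c1 _ Kr) (c2 _ Kr) hK.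
  have d2 : is_derive (s + h) (1 : R) (fun u : R => u - s) 1.
    by apply: is_derive_eq; ring.
  have d1' : is_derive (s + h - s) (1 : R) (fun x => limn (pseries a x))
      (limn (pseries (pseries_diffs a) h)).
    by rewrite (_ : s + h - s = h)//; ring.
  have := @is_derive1_comp _ _ (fun u : R => u - s) _ _ _ d1' d2.
  rewrite mulr1; apply: near_eq_is_derive.
  near=> u; rewrite /=.
  have -> : psi u = psi (s + (u - s)) by congr psi; ring.
  apply: cvg_lim => //; apply: ha.
  have : `|s + h - u| < r - `|h|.
    by near: u; apply: nbhsx_ballx; rewrite subr_gt0.
  rewrite ltrBrDr; apply: le_lt_trans.
  rewrite -[leLHS]normrN (_ : - (u - s) = (s + h - u) + - h); last by ring.
  by rewrite (le_trans (ler_normD _ _))// normrN.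
split=> s.
  have [r [r0 [a ha]]] := main s.
  have [|d _] := ha 0; first by rewrite normr0.
  by rewrite addr0 in d; rewrite derive1E derive_val.
have [r [r0 [a ha]]] := main s; exists r; split=> //; exists a => h hr.
by have [d c] := ha _ hr; rewrite derive1E derive_val.
Unshelve. all: by end_near. Qed.

Lemma locally_pseries_is_derive1n (psi : R -> R) : locally_pseries psi ->
  forall k (s : R), is_derive s (1 : R) (derive1n k psi) (derive1n k.+1 psi s).
Proof.
move=> lp k; suff : locally_pseries (derive1n k psi).
  by move=> /locally_pseries_derive[].
by elim: k => // k /locally_pseries_derive[].
Qed.

(** Increments [(0, h)] kill every monomial with [i > 0], leaving the series of [c 0]; [a != 0]
    keeps the line off the origin. *)
Lemma locally_pseries_vert (F : R * R -> R) (a : R) : a != 0 ->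
  (forall xi : R * R, xi != 0 -> real_analytic_at F xi) ->
  locally_pseries (fun s => F (a, s)).
Proof.
move=> a0 anF s.
have [|r [r0 [c hc]]] := anF (a, s); first by rewrite xpair_eqE negb_and a0.
exists r; split=> //; exists (c 0%N) => h hr.
have [|_] := hc (0, h) _ hr; first by rewrite normr0.
have -> : (a, s) + (0, h) = (a + 0, s + h) :> R * R by [].
rewrite addr0; apply: cvg_trans; apply: near_eq_cvg; apply: nearW => n.
rewrite /psum2 /pseries /series/= big_mkord.
case: n => [|n]; first by rewrite !big_ord0.
rewrite [LHS]big_ord_recl [X in _ + X = _]big1 ?addr0.
  by apply: eq_bigr => j _; rewrite expr0 mulr1.
by move=> i _; apply: big1 => j _; rewrite expr0n/= mulr0 mul0r.
Qed.

Lemma locally_pseries_horiz (F : R * R -> R) (b : R) : b != 0 ->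
  (forall xi : R * R, xi != 0 -> real_analytic_at F xi) ->
  locally_pseries (fun s => F (s, b)).
Proof.
move=> b0 anF s.
have [|r [r0 [c hc]]] := anF (s, b).
  by rewrite xpair_eqE negb_and b0 orbT.
exists r; split=> //; exists (c^~ 0%N) => h hr.
have [|_] := hc (h, 0) hr; first by rewrite normr0.
have -> : (s, b) + (h, 0) = (s + h, b + 0) :> R * R by [].
rewrite addr0; apply: cvg_trans; apply: near_eq_cvg; apply: nearW => n.
rewrite /psum2 /pseries /series/= big_mkord.
case: n => [|n]; first by rewrite !big_ord0.
apply: eq_bigr => i _; rewrite big_ord_recl big1 ?addr0 ?expr0 ?mulr1//.
by move=> j _; rewrite expr0n/= mulr0.
Qed.
End PowerSeries.

(** * Smoothness of homogeneous functions on the circle *)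

Section CircleFunctions.
Variables (R : realType) (psi : nat -> R -> R) (A B C D : R).
Hypothesis psi_derive :
  forall k (s : R), is_derive s (1 : R) (psi k) (psi k.+1 s).

Let trig (a b t : R) : R := a * cos t + b * sin t.
(** In the application [c] is [cos] or [sin] up to sign and [s] the other one, so [c > 0] is a half
    circle and [s / c] a coordinate on it. *)
Let c : R -> R := trig A B.
Let s : R -> R := trig C D.

(* A class of functions stable under differentiation on [c > 0]. *)
Inductive circle_fun : (R -> R) -> Prop :=
| circle_psi k : circle_fun (fun t => psi k (s t / c t))
| circle_inv : circle_fun (fun t => (c t)^-1)
| circle_trig a b : circle_fun (trig a b)
| circle_add f g : circle_fun f -> circle_fun g ->
    circle_fun (fun t => f t + g t)
| circle_mul f g : circle_fun f -> circle_fun g ->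
    circle_fun (fun t => f t * g t).

Let is_derive_trig (a b t : R) : is_derive t (1 : R) (trig a b) (trig b (- a) t).
Proof. by apply: is_derive_eq; rewrite /trig /GRing.scale/=; ring. Qed.

Let is_derive_inv (t : R) : 0 < c t ->
  is_derive t (1 : R) (fun t => (c t)^-1)
    (trig (- B) A t * ((c t)^-1 * (c t)^-1)).
Proof.
move=> c0; have d := is_deriveV (lt0r_neq0 c0) (is_derive_trig A B t).
apply: (is_derive_eq d).
by rewrite /trig /GRing.scale/= expr2 invfM; ring.
Qed.

(** The chain rule turns [psi k] into [psi k.+1], which is why the class holds the whole
    sequence. *)
Lemma circle_fun_derive (f : R -> R) : circle_fun f ->
  exists2 g, circle_fun g &
    forall t : R, 0 < c t -> is_derive t (1 : R) f (g t).
Proof.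
elim=> {f} [k||a b|f g _ [f' Sf' df] _ [g' Sg' dg]|f g Sf [f' Sf' df] Sg [g' Sg' dg]].
- exists (fun t => psi k.+1 (s t / c t) *
    (trig D (- C) t * (c t)^-1
     + trig C D t * (trig (- B) A t * ((c t)^-1 * (c t)^-1)))).
    by do ?[exact: circle_trig|exact: circle_inv|exact: circle_psi
      |apply: circle_mul|apply: circle_add].
  move=> t c0.
  have d1 := is_deriveM (is_derive_trig C D t) (is_derive_inv c0).
  have d2 := @is_derive1_comp _ _ _ _ _ _ (psi_derive k _) d1.
  apply: (is_derive_eq d2).
  by congr (_ * _); rewrite /GRing.scale/=; ring.
- exists (fun t => trig (- B) A t * ((c t)^-1 * (c t)^-1)).
    by do ?[exact: circle_trig|exact: circle_inv|apply: circle_mul].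
  exact: is_derive_inv.
- by exists (trig b (- a)) => [|t _]; [exact: circle_trig|exact: is_derive_trig].
- exists (fun t => f' t + g' t); first exact: circle_add.
  by move=> t c0; apply: is_deriveD; [exact: df|exact: dg].
- exists (fun t => f t * g' t + g t * f' t).
    by apply: circle_add; apply: circle_mul.
  by move=> t c0; apply: is_deriveM; [exact: df|exact: dg].
Qed.

(** Inductively each iterated derivative of [f0] agrees on the arc [c > 0] with a member of the
    class; the arc being open, agreement passes to derivatives. *)
Lemma circle_fun_derive1n (f f0 : R -> R) : circle_fun f ->
  (forall t, 0 < c t -> f0 t = f t) ->
  forall n (t : R), 0 < c t ->
    is_derive t (1 : R) (derive1n n f0) (derive1n n.+1 f0 t).
Proof.
move=> Sf ff0.
have near_c t : 0 < c t -> \forall u \near t, 0 < c u.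
  move=> c0.
  have ct : {for t, continuous c}.
    apply: differentiable_continuous; apply/derivable1_diffP.
    by have [] := is_derive_trig A B t.
  exact: (ct _ (lt_nbhsr c0)).
have step n g : circle_fun g -> (forall t, 0 < c t -> derive1n n f0 t = g t) ->
    exists2 h, circle_fun h & forall t : R, 0 < c t ->
      is_derive t (1 : R) (derive1n n f0) (h t).
  move=> Sg eg; have [h Sh dh] := circle_fun_derive Sg; exists h => // t c0.
  apply: near_eq_is_derive (dh _ c0).
  by near do (rewrite eg//); exact: near_c.
have all n : exists2 g, circle_fun g &
    forall t, 0 < c t -> derive1n n f0 t = g t.
  elim: n => [|n [g Sg eg]]; first by exists f.
  have [h Sh dh] := step _ _ Sg eg; exists h => // t c0.
  by rewrite derive1nS derive1E; have := dh _ c0 => ?; rewrite derive_val.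
move=> n t c0; have [g Sg eg] := all n.
have [h Sh dh] := step _ _ Sg eg; have d := dh _ c0.
by rewrite derive1nS derive1E derive_val.
Unshelve. all: by end_near. Qed.

End CircleFunctions.

Lemma homogeneous_analytic_circle (R : realType) (F : R * R -> R) :
  (forall (xi : R * R) (t : R), xi != 0 -> 0 < t -> F (t *: xi) = t * F xi) ->
  (forall xi : R * R, xi != 0 -> real_analytic_at F xi) ->
  forall n (t : R), is_derive t (1 : R)
    (derive1n n (fun u : R => F (cos u, sin u)))
    (derive1n n.+1 (fun u : R => F (cos u, sin u)) t).
Proof.
move=> homF anF n t.
have key (psi : R -> R) (A B C D : R) : locally_pseries psi ->
    (forall u, 0 < A * cos u + B * sin u -> F (cos u, sin u) =
      (A * cos u + B * sin u) *
      psi ((C * cos u + D * sin u) / (A * cos u + B * sin u))) ->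
    0 < A * cos t + B * sin t ->
    is_derive t (1 : R)
      (derive1n n (fun u : R => F (cos u, sin u)))
      (derive1n n.+1 (fun u : R => F (cos u, sin u)) t).
  move=> lp eF c0.
  have dpsi := locally_pseries_is_derive1n lp.
  apply: (@circle_fun_derive1n R (fun k => derive1n k psi) A B C D dpsi
    (fun u => (A * cos u + B * sin u) *
      psi ((C * cos u + D * sin u) / (A * cos u + B * sin u)))) => //.
  apply: circle_mul; first exact: circle_trig.
  exact: (circle_psi (fun k => derive1n k psi) A B C D 0).
have scale (a u v : R) : 0 < a -> (u != 0) || (v != 0) ->
    F (a * u, a * v) = a * F (u, v).
  by move=> a0 uv; rewrite -homF// xpair_eqE negb_and.
(* Four arcs cover the circle, since [sin t] is 1 or -1 where [cos t = 0]. On each, [psi] is [F]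
   along the tangent line at the midpoint of the arc. *)
have [c0|c0|c0] := ltgtP (cos t) 0.
- apply: (key (fun s => F (-1, s)) (-1) 0 0 1); last by lra.
    by apply: locally_pseries_vert => //; rewrite oppr_eq0 oner_eq0.
  move=> u; rewrite !mul0r !mul1r addr0 add0r mulN1r => cu.
  rewrite -scale// ?oppr_eq0 ?oner_eq0// mulrN1 opprK mulrC divfK//.
  by rewrite lt0r_neq0.
- apply: (key (fun s => F (1, s)) 1 0 0 1); last by lra.
    by apply: locally_pseries_vert => //; rewrite oner_eq0.
  move=> u; rewrite !mul0r !mul1r addr0 add0r => cu.
  rewrite -scale// ?oner_eq0// mulr1 [_ * (_ / _)]mulrC divfK//.
  by rewrite lt0r_neq0.
have := cos2Dsin2 t; rewrite c0 expr0n/= add0r => /eqP.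
rewrite sqrf_eq1 => /orP[] /eqP s1.
- apply: (key (fun s => F (s, 1)) 0 1 1 0); last by lra.
    by apply: locally_pseries_horiz => //; rewrite oner_eq0.
  move=> u; rewrite !mul0r !mul1r addr0 add0r => cu.
  rewrite -scale// ?oner_eq0 ?orbT// mulr1 [_ * (_ / _)]mulrC divfK//.
  by rewrite lt0r_neq0.
- apply: (key (fun s => F (s, -1)) 0 (-1) 1 0); last by lra.
    by apply: locally_pseries_horiz => //; rewrite oppr_eq0 oner_eq0.
  move=> u; rewrite !mul0r !mul1r addr0 add0r mulN1r => cu.
  rewrite -scale// ?oppr_eq0 ?oner_eq0 ?orbT// mulrN1 opprK mulrC divfK//.
  by rewrite lt0r_neq0.
Qed.

(** * Polar coordinates *)

Section Polar.
Variable R : realType.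
Implicit Types u v : R * R.

(** The angle is [acos u.1] with the sign of the second coordinate; its absolute value is kept to be
    compared with [angle2]. *)
Lemma unit_vector_polar u : dot2 u u = 1 ->
  exists2 th : R, `|th| = acos u.1 & u = (cos th, sin th).
Proof.
case: u => a b; rewrite /dot2/= -!expr2 => ab1.
have a1 : -1 <= a <= 1.
  by have b2 := sqr_ge0 b; apply/andP; split; nra.
have ca : cos (acos a) = a by rewrite acosK// in_itv.
have sa : sin (acos a) = `|b|.
  by rewrite sin_acos// -ab1 addrAC subrr add0r sqrtr_sqr.
have a0 := acos_ge0 a1.
have [b0|b0] := leP 0 b.
- by exists (acos a); [rewrite ger0_norm|rewrite ca sa ger0_norm].
- exists (- acos a); first by rewrite normrN ger0_norm.
  by rewrite cosN sinN ca sa ltr0_norm// opprK.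
Qed.

Lemma cos_sin_neq0 (t : R) : (cos t, sin t) != 0 :> R * R.
Proof.
rewrite xpair_eqE; apply/negP => /andP[/eqP c0 /eqP s0].
by have /eqP := cos2Dsin2 t; rewrite c0 s0 expr0n addr0 eq_sym oner_eq0.
Qed.

Lemma dot2_gt0 v : v != 0 -> 0 < dot2 v v.
Proof.
case: v => a b; rewrite xpair_eqE negb_and /dot2/= -!expr2 => /orP[] h.
- by rewrite ltr_wpDr ?sqr_ge0// exprn_even_gt0.
- by rewrite ltr_wpDl ?sqr_ge0// exprn_even_gt0.
Qed.

Lemma enorm2_gt0 v : v != 0 -> 0 < enorm2 v.
Proof. by move=> v0; rewrite sqrtr_gt0 dot2_gt0. Qed.

Lemma polar_from (th : R) v : v != 0 -> exists2 tau : R,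
  `|tau| = angle2 v (cos th, sin th) &
  v = enorm2 v *: (cos (th + tau), sin (th + tau)).
Proof.
move=> v0; have r0 := enorm2_gt0 v0.
have r2 : enorm2 v ^+ 2 = dot2 v v by rewrite sqr_sqrtr// ltW// dot2_gt0.
have u1 : enorm2 (cos th, sin th) = 1.
  by rewrite /enorm2 /dot2/= -!expr2 cos2Dsin2 sqrtr1.
have cs := cos2Dsin2 th.
(* This is [v] normalised and rotated by [- th]; its first coordinate is the cosine of the angle
   between [v] and the direction [th]. *)
pose w := ((v.1 * cos th + v.2 * sin th) / enorm2 v,
           (v.2 * cos th - v.1 * sin th) / enorm2 v).
have w1 : dot2 w w = 1.
  rewrite /dot2/= -!expr2 !expr_div_n -mulrDl r2 /dot2.
  apply: (canLR (mulfK (lt0r_neq0 (dot2_gt0 v0)))).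
  have -> : 1 * (v.1 * v.1 + v.2 * v.2) =
    (cos th ^+ 2 + sin th ^+ 2) * (v.1 * v.1 + v.2 * v.2) by rewrite cs.
  by ring.
have [tau tauE wE] := unit_vector_polar w1.
exists tau; first by rewrite tauE /angle2 u1 mulr1.
case: (wE) => e1 e2.
have ring_id (a b : R) : a = a * (cos th ^+ 2 + sin th ^+ 2) + b * 0.
  by rewrite cs; ring.
rewrite cosD sinD -e1 -e2 [LHS]surjective_pairing; move: (lt0r_neq0 r0).
have scale_pair (a x y : R) : a *: (x, y) = (a * x, a * y) :> R * R by [].
move: (enorm2 v) => r r0'; rewrite scale_pair; congr (_, _).
- by rewrite {1}(ring_id v.1 v.2); field.
- by rewrite {1}(ring_id v.2 v.1); field.
Qed.
End Polar.

(** * Taylor approximation of the complex exponential *)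

Section ComplexExponential.
Variable R : realType.

Lemma normc_le (a b : R) : `|(a +i* b)%C| <= (`|a| + `|b|)%:C%C.
Proof.
rewrite normc_def lecR /= -[leRHS]ger0_norm ?addr_ge0// -sqrtr_sqr.
rewrite ler_wsqrtr// sqrrD !real_normK ?num_real//.
by rewrite lerD2r lerDl mulrn_wge0// mulr_ge0.
Qed.

(** This is [i^m / m!]; the summand 0 is the base point of the Taylor bounds. *)
Definition expi_coef (m : nat) : R[i] :=
  (cos (0 + m%:R * (pi / 2)) / m`!%:R +i* (sin (0 + m%:R * (pi / 2)) / m`!%:R))%C.

Lemma sum_expi_coef (n : nat) (A : R) :
  \sum_(m < n) expi_coef m * (A ^+ m)%:C%C =
  ((\sum_(m < n) cos (0 + m%:R * (pi / 2)) / m`!%:R * A ^+ m) +i*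
   (\sum_(m < n) sin (0 + m%:R * (pi / 2)) / m`!%:R * A ^+ m))%C.
Proof.
elim: n => [|n IH]; first by rewrite !big_ord0.
rewrite !big_ord_recr/= IH; apply/eqP; rewrite eq_complex/=.
by apply/andP; split; apply/eqP; ring.
Qed.

(** Replacing [phi] by [A] costs [delta], by the Taylor bounds of order 1; truncating at [A] costs
    the other term. The factor 2 sums real and imaginary parts. *)
Lemma expi_taylor (n : nat) (phi A L delta : R) :
  `|A| <= L -> `|phi - A| <= delta ->
  `|expi phi - \sum_(m < n) expi_coef m * (A ^+ m)%:C%C|
    <= (2 * (delta + L ^+ n / n`!%:R))%:C%C.
Proof.
move=> AL dA; rewrite sum_expi_coef.
have An : `|A| ^+ n / n`!%:R <= L ^+ n / n`!%:R.
  by rewrite ler_wpM2r ?invr_ge0// lerXn2r// nnegrE (le_trans _ AL).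
have c1 := le_trans (cos_taylor_bound n 0 A) An.
have s1 := le_trans (sin_taylor_bound n 0 A) An.
have c2 := cos_taylor_bound 1 A (phi - A).
have s2 := sin_taylor_bound 1 A (phi - A).
move: c2 s2; rewrite !big_ord1 !mul0r !addr0 !divr1 !expr0 !mulr1 expr1.
rewrite [A + _]addrC subrK => /le_trans/(_ dA) c2 /le_trans/(_ dA) s2.
rewrite add0r in c1; rewrite add0r in s1.
apply: (le_trans (normc_le _ _)); rewrite lecR mulr_natl mulr2n.
by apply: lerD; [rewrite -(subrKA (cos A))|rewrite -(subrKA (sin A))];
  apply: (le_trans (ler_normD _ _)); apply: lerD.
Qed.

(** A term of a series of nonnegative terms. Applied to [2 * L], it bounds the truncation error
    [L^n / n!] by a multiple of [2^-n]. *)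
Lemma exprn_fact_le_expR (x : R) (n : nat) : 0 <= x ->
  x ^+ n / n`!%:R <= expR x.
Proof.
move=> x0; case: n => [|n].
  by rewrite expr0 fact0 divr1 -expR0 ler_expR.
by rewrite (le_trans _ (expR_ge1Dxn n x0))// lerDr.
Qed.
End ComplexExponential.

(** * Separated sums and the growth of the rank *)

Section SeparationRank.
Variable R : realType.
Implicit Types (D : set (R * R)) (f : R * R -> R * R -> R[i]).

(** Pairs are numbered row by row, [k = i * b + j], to match the single index of [sep_approx]. *)
Lemma sum_divn_modn (V : zmodType) (a b : nat) (G : nat -> nat -> V) :
  \sum_(i < a) \sum_(j < b) G i j =
  \sum_(k < a * b) G (k %/ b)%N (k %% b)%N.
Proof.
rewrite -(big_mkord xpredT (fun k => G (k %/ b)%N (k %% b)%N)).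
elim: a => [|a IH]; first by rewrite big_ord0 big_geq.
rewrite big_ord_recr/= IH mulSnr (@big_cat_nat _ _ _ (a * b) 0 (a * b + b)) ?leq_addr//=.
congr (_ + _); rewrite -[X in \sum_(X <= _ < _) _]add0n big_addn addKn big_mkord.
apply: eq_bigr => j _; have b0 : (0 < b)%N := leq_ltn_trans (leq0n j) (ltn_ord j).
by rewrite addnC divnMDl// modnMDl divn_small ?addn0 ?modn_small.
Qed.

Lemma sep_approx_double_sum D1 D2 f (eps : R) (a b : nat)
    (c d : nat -> nat -> R * R -> R[i]) :
  (forall x xi, D1 x -> D2 xi ->
    `|f x xi - \sum_(i < a) \sum_(j < b) c i j x * d i j xi| <= eps%:C%C) ->
  sep_approx D1 D2 f eps (a * b).
Proof.
move=> H; exists (fun k => c (k %/ b)%N (k %% b)%N).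
exists (fun k => d (k %/ b)%N (k %% b)%N) => x xi Dx Dxi.
by have := H x xi Dx Dxi; rewrite (sum_divn_modn _ _ (fun i j => c i j x * d i j xi)).
Qed.

Lemma sep_approx_le D1 D2 f (eps eps' : R) (r : nat) : eps <= eps' ->
  sep_approx D1 D2 f eps r -> sep_approx D1 D2 f eps' r.
Proof.
move=> le [c [d H]]; exists c, d => x xi Dx Dxi.
by rewrite (le_trans (H x xi Dx Dxi))// lecR.
Qed.

(* With [y = eps^(-p/3)], the choice [n ~ c y] makes [C 2^-n <= eps] because
   [- ln eps = (3/p) ln y <= (3/p) y], while [n^3 = O(y^3) = O(eps^-p)]. *)
Lemma sep_rank_cubic D1 D2 f (C p : R) : 0 < C -> 0 < p ->
  (forall n : nat, sep_approx D1 D2 f (C * 2 ^- n) (n * (n * n))) ->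
  exists Cp : R, 0 < Cp /\ forall eps : R, 0 < eps -> eps <= 1 ->
    (sep_rank D1 D2 f eps <= (Cp * powR eps (- p))%:E)%E.
Proof.
move=> C0 p0 H.
have l2 : 0 < ln (2 : R) by rewrite ln_gt0// ltr1n.
(* Chosen so that [c * y * ln 2] dominates [ln C - ln eps] once [y >= 1]. *)
pose c := (`|ln C| + 3 / p) / ln 2.
have c0 : 0 <= c by rewrite divr_ge0 ?addr_ge0 ?divr_ge0// ltW.
exists ((c + 1) ^+ 3); split; first by rewrite exprn_gt0// ltr_wpDl.
move=> eps eps0 eps1.
pose y := powR eps (- (p / 3)).
have y0 : 0 < y by rewrite powR_gt0.
have lny : ln y = - (p / 3) * ln eps by rewrite ln_powR.
have y1 : 1 <= y.
  by rewrite -ler_ln ?posrE// ln1 lny mulr_le0// ?ln_le0// oppr_le0 divr_ge0// ltW.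
have lneps : - ln eps <= 3 / p * y.
  have -> : - ln eps = 3 / p * ln y by rewrite lny; field; rewrite lt0r_neq0.
  by rewrite ler_wpM2l ?divr_ge0 ?(ltW p0)// ltW// ln_sublinear.
(* Strictly above [c * y], and at most [(c + 1) * y] because [y >= 1]; cubing gives the constant. *)
pose n := (Num.trunc (c * y)).+1.
have n1 : c * y < n%:R by rewrite truncnS_gt.
have n2 : n%:R <= (c + 1) * y.
  rewrite -natr1 mulrDl mul1r lerD// truncn_le mulr_ge0// ltW//.
have errn : C * 2 ^- n <= eps.
  rewrite -ler_ln ?posrE ?mulr_gt0 ?invr_gt0 ?exprn_gt0//.
  rewrite lnM ?posrE ?invr_gt0 ?exprn_gt0// lnV ?posrE ?exprn_gt0// lnXn//.
  have : c * y * ln 2 <= n%:R * ln 2 by rewrite ler_wpM2r// ltW.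
  rewrite /c mulrAC divfK ?lt0r_neq0// mulrDl => h.
  have : `|ln C| <= `|ln C| * y by rewrite ler_peMr.
  have := ler_norm (ln C); rewrite mulr_natl in h.
  lra.
apply: (@le_trans _ _ (n * (n * n))%:R%:E).
  apply: ereal_inf_lbound; exists (n * (n * n))%N => //.
  exact: sep_approx_le errn (H n).
have -> : powR eps (- p) = y ^+ 3.
  rewrite -powR_mulrn ?ltW// -powRrM; congr powR.
  by field.
rewrite lee_fin -exprMn (_ : (n * (n * n))%N = (n ^ 3)%N); last first.
  by rewrite !expnS expn0 muln1.
by rewrite natrX lerXn2r ?nnegrE// ?mulr_ge0 ?addr_ge0// ltW.
Qed.
End SeparationRank.

(* The powers of [rho * P.[tau]] only involve the monomials [rho^m tau^j] with
   [m < n] and [j < n^2], which bounds the rank polynomially in [n]. *)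
Lemma expi_sep_approx (R : realType) (D W : set (R * R))
    (phi : R * R -> R * R -> R) (rho tau : R * R -> R)
    (P : R * R -> {poly R}) (n : nat) (L delta : R) :
  (forall x, (size (P x) <= n)%N) ->
  (forall x xi, D x -> W xi -> `|rho xi * (P x).[tau xi]| <= L) ->
  (forall x xi, D x -> W xi ->
    `|phi x xi - rho xi * (P x).[tau xi]| <= delta) ->
  sep_approx D W (fun x xi => expi (phi x xi))
    (2 * (delta + L ^+ n / n`!%:R)) (n * (n * n)).
Proof.
move=> sP PL Pd.
apply: (@sep_approx_double_sum _ _ _ _ _ _ _
  (fun m j x => expi_coef R m * ((P x ^+ m)`_j)%:C%C)
  (fun m j xi => (rho xi ^+ m * tau xi ^+ j)%:C%C)) => x xi Dx Wxi.
rewrite [X in _ - X](_ : _ =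
  \sum_(m < n) expi_coef R m * ((rho xi * (P x).[tau xi]) ^+ m)%:C%C).
  by apply: expi_taylor; [exact: PL|exact: Pd].
apply: eq_bigr => m _.
rewrite exprMn -horner_exp (@horner_coef_wide _ (n * n)); last first.
  (* The degree is at most [(n - 1)^2], so [n * n] coefficients suffice; [n > 0] because [m < n]. *)
  apply: (leq_trans (size_poly_exp_leq _ _)).
  have mn := ltn_ord m; have n0 : (0 < n)%N := leq_ltn_trans (leq0n m) mn.
  apply: (@leq_trans (n.-1 * n.-1).+1).
    rewrite ltnS leq_mul//; last by lia.
    by have sx := sP x; move: (size (P x)) sx => k; lia.
  by nia.
rewrite mulr_sumr rmorph_sum mulr_sumr; apply: eq_bigr => j _.
by rewrite !rmorphM/=; ring.
Qed.

(** * Geometry of the wedge and the final error estimates *)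

(** Both coordinates are at most [N / 2] in absolute value; the crude bound only affects the
    constant. *)
Lemma enorm2_wedge_le (R : realType) (N : nat) (alpha : R) (xih xi : R * R) :
  wedge N alpha xih xi -> enorm2 xi <= N%:R.
Proof.
case: xi => a b [_ /= [/andP[a1 a2] [/andP[b1 b2] _]]].
rewrite -[leRHS]ger0_norm// -sqrtr_sqr ler_wsqrtr// /dot2/=.
by nra.
Qed.

Theorem theorem2 (R : realType) (N : nat) (alpha : R)
    (Phi : R * R -> R * R -> R) (xih : R * R) (Q Rr : R) :
  (0 < N)%N -> ~~ odd N -> 0 < alpha ->
  (* homogeneity of degree one in xi *)
  (forall (x xi : R * R) (t : R), unit_square x -> xi != 0 -> 0 < t ->
     Phi x (t *: xi) = t * Phi x xi) ->
  (* xih is a (Euclidean) unit vector *)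
  dot2 xih xih = 1 ->
  (* the gradient of Phi(x, .) at xih exists *)
  (forall x, unit_square x -> differentiable (Phi x) xih) ->
  let Phil := fun x xi : R * R => Phi x xi - 'd (Phi x) xih xi in
  (forall xi : R * R, xi != 0 -> measurable_fun unit_square (fun x => Phil x xi)) ->
  0 < Q -> 0 < Rr -> QR_analytic unit_square Phil Q Rr ->
  alpha < Rr * Num.sqrt (N%:R) / 2 ->
  alpha < Rr / Num.sqrt (Num.sqrt 2 * Q) ->
  forall p : R, 2 / (ln (Rr * Num.sqrt (N%:R) / alpha) / ln 2) < p ->
  exists Cp : R, 0 < Cp /\
    forall eps : R, 0 < eps -> eps <= 1 ->
      (sep_rank unit_square (wedge N alpha xih)
         (fun x xi => expi (2 * pi * Phil x xi)) eps
       <= (Cp * powR eps (- p))%:E)%E.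
Proof.
move=> N0 _ alpha0 homPhi xih1 _ Phil _ Q0 Rr0 anPhil alphaR _ p ltp.
have sN0 : 0 < Num.sqrt (N%:R : R) by rewrite sqrtr_gt0 ltr0n.
(* Admissibility gives [Rr * sqrt N / alpha > 2], so the lower bound on [p] is nonnegative. *)
have p0 : 0 < p.
  apply: le_lt_trans ltp; rewrite divr_ge0// divr_ge0 ?ln_ge0//.
    by rewrite ler_pdivlMr// mul1r; lra.
  by rewrite ler1n.
have [th _ xihE] := unit_vector_polar xih1.
have hom x xi (t : R) : unit_square x -> xi != 0 -> 0 < t ->
    Phil x (t *: xi) = t * Phil x xi.
  by move=> Dx xi0 t0; rewrite /Phil homPhi// linearZ/= mulrBr.
(* The signed angle is chosen as a function of [xi] alone, as separation demands; [Rr / 2] bounds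
   the opening [alpha / sqrt N]. *)
have [tau tauP] : {tau : R * R -> R & forall xi, wedge N alpha xih xi ->
    `|tau xi| <= Rr / 2 /\
    xi = enorm2 xi *: (cos (th + tau xi), sin (th + tau xi))}.
  apply: (@choice _ _ (fun xi t => wedge N alpha xih xi -> `|t| <= Rr / 2 /\
    xi = enorm2 xi *: (cos (th + t), sin (th + t)))) => xi.
  (* The origin is outside the wedge, so its angle is arbitrary. *)
  have [xi0|xi0] := eqVneq xi 0; first by exists 0 => -[]; rewrite xi0 eqxx.
  have [t tE xiE] := polar_from th xi0; exists t => -[_ [_ [_ le]]].
  split=> //; rewrite tE -xihE (le_trans le)// ler_pdivrMr//; lra.
pose g x (t : R) := Phil x (cos t, sin t).
pose G x k (t : R) := 2 * pi * derive1n k (g x) t.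
have Gder x : unit_square x ->
    forall k (t : R), is_derive t (1 : R) (G x k) (G x k.+1 t).
  move=> Dx k t; have [an _] := anPhil _ Dx.
  have d := homogeneous_analytic_circle (fun xi t => hom x xi t Dx) an k t.
  exact: (is_deriveZ (2 * pi) d).
have Gle x k (t : R) : unit_square x -> `|G x k t| <= Q * k`!%:R * Rr ^- k.
  move=> Dx; have [_ /(_ k t)] := anPhil _ Dx.
  by rewrite normrM ger0_norm// mulr_ge0// pi_ge0.
pose P n x := taylor_poly n (fun k => G x k th).
have phiE x xi : unit_square x -> wedge N alpha xih xi ->
    2 * pi * Phil x xi = enorm2 xi * G x 0%N (th + tau xi).
  move=> Dx Wxi; have [_ e] := tauP _ Wxi; have [xi0 _] := Wxi.
  rewrite {1}e hom//; first by rewrite /G /g/=; ring.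
    exact: cos_sin_neq0.
  exact: enorm2_gt0.
have GP n x xi : unit_square x -> wedge N alpha xih xi ->
    `|G x 0%N (th + tau xi) - (P n x).[tau xi]| <= Q * 2 ^- n.
  move=> Dx Wxi; have [le _] := tauP _ Wxi.
  rewrite horner_taylor_poly.
  apply: (le_trans (taylor_bound th _ (Gder x Dx) (fun s => Gle x n s Dx))).
  (* The factorial in the derivative bound cancels that of the remainder, leaving a geometric term
     of ratio at most 1/2. *)
  have -> : Q * n`!%:R * Rr ^- n * `|tau xi| ^+ n / n`!%:R
      = Q * (`|tau xi| / Rr) ^+ n.
    rewrite expr_div_n; field.
    by rewrite pnatr_eq0 -lt0n fact_gt0 expf_neq0// lt0r_neq0.
  rewrite ler_wpM2l ?(ltW Q0)// -exprVn lerXn2r ?nnegrE ?divr_ge0 ?(ltW Rr0)//.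
  by rewrite ler_pdivrMr// mulrC.
have two_n (n : nat) : 0 < (2 : R) ^- n <= 1.
  by rewrite invr_gt0 exprn_gt0//= invf_le1 ?exprn_gt0// exprn_ege1// ler1n.
have phiP n x xi : unit_square x -> wedge N alpha xih xi ->
    `|2 * pi * Phil x xi - enorm2 xi * (P n x).[tau xi]| <= N%:R * Q * 2 ^- n.
  move=> Dx Wxi; rewrite phiE// -mulrBr normrM ger0_norm ?sqrtr_ge0// -mulrA.
  by rewrite ler_pM ?sqrtr_ge0// ?GP// (enorm2_wedge_le Wxi).
have phi_le x xi : unit_square x -> wedge N alpha xih xi ->
    `|2 * pi * Phil x xi| <= N%:R * Q.
  move=> Dx Wxi; rewrite phiE// normrM ger0_norm ?sqrtr_ge0//.
  rewrite ler_pM ?sqrtr_ge0// ?(enorm2_wedge_le Wxi)//.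
  by have := Gle x 0%N (th + tau xi) Dx; rewrite fact0 expr0 invr1 !mulr1.
(* The phase and the approximation error are each at most [N * Q], so [L] bounds the approximants
   uniformly in [n]. *)
pose L := 2 * N%:R * Q.
have NQ0 : 0 <= N%:R * Q by rewrite mulr_ge0// ltW.
have L0 : 0 <= L by rewrite /L -mulrA mulr_ge0.
(* The exponential comes from [L^n / n! = 2^-n (2 L)^n / n!]. *)
apply: (@sep_rank_cubic _ _ _ _ (2 * (N%:R * Q + expR (2 * L)))) => //.
  by rewrite mulr_gt0// ltr_wpDl// expR_gt0.
move=> n.
have := @expi_sep_approx _ unit_square (wedge N alpha xih)
  (fun x xi => 2 * pi * Phil x xi) (@enorm2 R) tau (P n) n L (N%:R * Q * 2 ^- n).
move=> H; apply: sep_approx_le (H _ _ _).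
- rewrite -[leRHS]mulrA ler_wpM2l// mulrDl lerD2l ler_pdivlMr ?exprn_gt0//.
  by rewrite mulrAC -exprMn [L * 2]mulrC exprn_fact_le_expR// mulr_ge0.
- by move=> x; apply: size_poly.
- move=> x xi Dx Wxi; have := phiP n x xi Dx Wxi; rewrite distrC => h.
  rewrite -[X in `|X|](subrK (2 * pi * Phil x xi)).
  apply: (le_trans (ler_normD _ _)).
  have h2 : N%:R * Q * 2 ^- n <= N%:R * Q.
    by rewrite ler_piMr//; case/andP: (two_n n).
  have -> : L = N%:R * Q + N%:R * Q by rewrite /L; ring.
  exact: lerD (le_trans h h2) (phi_le x xi Dx Wxi).
- by move=> x xi; exact: phiP.
Qed.
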